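(* Let $x>0$, $n\in\mathbb{N}=\{1,2,\dots\}$, $\varepsilon\in\left(1-\frac{\sqrt3}{2},\,1\right]$ and $$\alpha\in\left(0,\ 2\arccos\frac{\sqrt{1+4(1-\varepsilon)^2}}{2}\right].$$ Then the polynomial $p_n$ satisfies $$|p_n(x)|\le \sqrt{\frac{(2^{4n}-1)\,(4n)!\,\sin(\alpha/2)}{\pi n\,\alpha^{4n}\,\left(2^{4n-2}+6/\pi^2-1\right)}}\ \frac{e^{\varepsilon x}}{2}.$$
   Context: Let $\mathcal{A}_x$ be the differential operator $\mathcal{A}_x = x^2 - x\frac{d}{dx}x\frac{d}{dx}$, i.e. $(\mathcal{A}_x f)(x)=x^2f(x)-x\,(x f'(x))'$. For $n\in\mathbb{N}_0$ define $p_n(x)=(-1)^n e^{x}\mathcal{A}_x^n e^{-x}$, where $\mathcal{A}_x^n$ is the $n$-th iterate. Each $p_n$ is a polynomial of degree $n$ in $x$; e.g. $p_0=1$, $p_1=-x$, $p_2=3x^2-x$. *)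

(* Defs.v *)
(* Stdlib world, with Coquelicot's total derivative [Derive]. *)
From Stdlib Require Export Reals.
From Coquelicot Require Export Coquelicot.
Open Scope R_scope.

Definition opA (f : R -> R) : R -> R :=
  fun x => x ^ 2 * f x - x * Derive (fun y => y * Derive f y) x.

(* [Derive] is total, with a meaningless value at points of
   non-differentiability; this does not matter here, since every iterate of
   [opA] on [exp (- y)] is smooth on the whole real line. *)
Definition p (n : nat) (x : R) : R :=
  (-1) ^ n * exp x * Nat.iter n opA (fun y => exp (- y)) x.

(* Main.v *)
Require Import Defs.
From Stdlib Require Import Reals Factorial ZArith Lra Lia Psatz.
From Coquelicot Require Import Coquelicot.
Open Scope R_scope.

(** The operator sends [exp (- x cosh u)] to minus its second derivative in
    [u].  Hence [p n x] is the [2n]-th derivative at [u = 0] of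
    [exp (- x (cosh u - 1))], that is
    [p n x = sum_k (-1)^k c(n,k) x^k], where [c(n,k) / (2n)!] is the coefficient
    of [u^(2n)] in [(cosh u - 1)^k / k!].  The numbers [c(n,k)]
    ([cosh_coef]) are nonnegative integers given by a triangular recurrence,
    and [p_eq_sum] proves this formula for [p] from the recurrence alone.

    Since the coefficients of [(cosh u - 1)^k / k!] are nonnegative, each is
    bounded by the value of the function:
    [c(n,k) rho^(2n) / (2n)! <= (cosh rho - 1)^k / k!] for [rho >= 0]
    ([cosh_coef_le]).  The sum for [p] alternates, so for [n >= 1] it is
    controlled by the even or by the odd part of an exponential series, which is
    worth a factor [1/2] ([p_le_majorant]):
    [|p n x| <= (2n)! / rho^(2n) * exp (eps x) / 2] when [cosh rho - 1 <= eps].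

    Put [r = alpha / 2].  The hypothesis on [alpha] implies
    [sin r ^ 2 <= 2 eps - eps^2 - 1/4] and [r <= PI / 3 < 21/20].  As
    [(2^(4n) - 1) / (2^(4n-2) + 6 / PI^2 - 1) > 4], it suffices to find [M] with
    [|p n x| <= M exp (eps x) / 2] and
    [M^2 * PI n (2r)^(4n) <= 4 (4n)! sin r] ([strong_bound]).

    For [n >= 8] the choice [rho^2 = 1/4 + 27/25 r^2] in the majorant works: it
    satisfies [cosh rho - 1 <= eps] ([cosh_radius_le]), and
    [q = r^2 / rho^2] stays below [0.77], so that the geometric factor [q^(2n)]
    beats the polynomial loss in
    [binomial(4n, 2n) / 16^n] ([large_n_case]).  For small [n] the loss
    dominates.  When [1 <= n <= 7], each monomial is estimated by its own maximum
    instead, [x^k <= (k / (e eps))^k exp (eps x)], and powers of [sin r] are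
    traded for powers of [eps] ([small_n_case]). *)

(** * The polynomials in closed form *)

(** The recurrence is the identity
    [g_k'' = k^2 g_k + (2k - 1) g_(k-1)] for [g_k = (cosh u - 1)^k / k!], read on
    Taylor coefficients.  Integer values make the polynomials of small degree
    computable. *)
Fixpoint cosh_coef (n k : nat) : Z :=
  match n, k with
  | O, O => 1
  | S m, S j => Z.of_nat k ^ 2 * cosh_coef m k + (2 * Z.of_nat j + 1) * cosh_coef m j
  | _, _ => 0
  end%Z.

Lemma cosh_coef_S (n j : nat) :
  IZR (cosh_coef (S n) (S j)) =
    INR (S j) ^ 2 * IZR (cosh_coef n (S j)) + (2 * INR j + 1) * IZR (cosh_coef n j).
Proof.
  change (cosh_coef (S n) (S j)) with
    (Z.of_nat (S j) ^ 2 * cosh_coef n (S j) + (2 * Z.of_nat j + 1) * cosh_coef n j)%Z.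
  rewrite plus_IZR, !mult_IZR, plus_IZR, mult_IZR, !INR_IZR_INZ.
  rewrite Z.pow_2_r, mult_IZR. ring.
Qed.

Lemma cosh_coef_gt (n k : nat) : (n < k)%nat -> cosh_coef n k = 0%Z.
Proof.
  revert k; induction n as [|n IH]; intros [|k] H; try lia; try reflexivity.
  change (cosh_coef (S n) (S k)) with
    (Z.of_nat (S k) ^ 2 * cosh_coef n (S k) + (2 * Z.of_nat k + 1) * cosh_coef n k)%Z.
  rewrite !IH by lia. ring.
Qed.

Lemma cosh_coef_ge0 (n k : nat) : 0 <= IZR (cosh_coef n k).
Proof.
  revert k; induction n as [|n IH]; intros [|k]; try (simpl; lra).
  rewrite cosh_coef_S.
  pose proof (IH k); pose proof (IH (S k)); pose proof (pos_INR k).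
  apply Rplus_le_le_0_compat; apply Rmult_le_pos; trivial; [apply pow2_ge_0|lra].
Qed.

(** The family of functions that [opA] preserves. *)
Definition exp_poly (a : nat -> R) (N : nat) (x : R) : R :=
  sum_f_R0 (fun k => a k * x ^ k) N * exp (- x).

Lemma is_derive_monomial_exp (c : R) (k : nat) (x : R) :
  is_derive (fun y => c * y ^ k * exp (- y)) x
    (c * (INR k * x ^ pred k - x ^ k) * exp (- x)).
Proof. auto_derive; trivial. ring. Qed.

Lemma is_derive_exp_poly (a : nat -> R) (N : nat) (x : R) :
  is_derive (exp_poly a N) x
    (sum_f_R0 (fun k => a k * (INR k * x ^ pred k - x ^ k)) N * exp (- x)).
Proof.
  induction N as [|N IH]; simpl sum_f_R0.
  - apply is_derive_monomial_exp.
  - rewrite Rmult_plus_distr_r.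
    apply is_derive_ext with
      (f := fun y => exp_poly a N y + a (S N) * y ^ S N * exp (- y)).
    { intros t; unfold exp_poly; simpl; ring. }
    apply (is_derive_plus (V := R_NormedModule)); [exact IH|].
    apply is_derive_monomial_exp.
Qed.

Lemma euler_derive_sum (a : nat -> R) (N : nat) (x : R) :
  x * sum_f_R0 (fun k => a k * (INR k * x ^ pred k - x ^ k)) N =
  sum_f_R0 (fun k => a k * (INR k * x ^ k - x ^ S k)) N.
Proof.
  rewrite scal_sum; apply sum_eq; intros [|i] _; simpl pred; [simpl; ring|].
  rewrite <- !tech_pow_Rmult; ring.
Qed.

(** The Euler operator [y d/dy] keeps the span of the functions
    [y^k exp (- y)], so the inner derivative in [opA] can be computed before the
    outer one is taken. *)
Lemma is_derive_euler_exp_poly (a : nat -> R) (N : nat) (x : R) :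
  is_derive (fun y => y * Derive (exp_poly a N) y) x
    (sum_f_R0 (fun k => a k * (INR k * (INR k * x ^ pred k - x ^ k)
        - ((INR k + 1) * x ^ k - x ^ S k))) N * exp (- x)).
Proof.
  apply is_derive_ext with
    (f := fun y => sum_f_R0 (fun k => a k * (INR k * y ^ k - y ^ S k)) N * exp (- y)).
  { intros t; rewrite (is_derive_unique _ _ _ (is_derive_exp_poly a N t)).
    rewrite <- Rmult_assoc, euler_derive_sum; reflexivity. }
  assert (H : forall k, is_derive (fun y => a k * (INR k * y ^ k - y ^ S k) * exp (- y)) x
    (a k * (INR k * (INR k * x ^ pred k - x ^ k)
        - ((INR k + 1) * x ^ k - x ^ S k)) * exp (- x))).
  { intros k; auto_derive; trivial.
    change (match k with O => 1 | S _ => INR k + 1 end) with (INR (S k)).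
    rewrite S_INR; simpl pow; ring. }
  induction N as [|N IH]; simpl sum_f_R0.
  - apply H.
  - rewrite Rmult_plus_distr_r.
    apply is_derive_ext with
      (f := fun y => sum_f_R0 (fun k => a k * (INR k * y ^ k - y ^ S k)) N * exp (- y)
         + a (S N) * (INR (S N) * y ^ S N - y ^ S (S N)) * exp (- y)).
    { intros t; symmetry; apply Rmult_plus_distr_r. }
    apply (is_derive_plus (V := R_NormedModule)); [exact IH|apply H].
Qed.

Lemma opA_exp_poly (a : nat -> R) (N : nat) (x : R) :
  opA (exp_poly a N) x =
  sum_f_R0 (fun k => a k * ((2 * INR k + 1) * x ^ S k - INR k ^ 2 * x ^ k)) N * exp (- x).
Proof.
  unfold opA.
  replace (Derive _ x) with
    (sum_f_R0 (fun k => a k * (INR k * (INR k * x ^ pred k - x ^ k)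
        - ((INR k + 1) * x ^ k - x ^ S k))) N * exp (- x))
    by (symmetry; apply is_derive_unique, is_derive_euler_exp_poly).
  unfold exp_poly. rewrite <- !Rmult_assoc, <- Rmult_minus_distr_r. f_equal.
  rewrite !scal_sum, <- minus_sum; apply sum_eq; intros [|i] _; simpl pred.
  - simpl; ring.
  - rewrite <- !tech_pow_Rmult; ring.
Qed.

Lemma opA_ext (f g : R -> R) (x : R) : (forall y, f y = g y) -> opA f x = opA g x.
Proof.
  intros H; unfold opA; rewrite H; do 2 f_equal.
  apply Derive_ext; intros t; f_equal; apply Derive_ext; exact H.
Qed.

(** On a single term,
    [opA (x^k exp (- x)) = ((2k + 1) x^(k+1) - k^2 x^k) exp (- x)]; collecting
    powers of [x] gives the recurrence of [cosh_coef], up to an alternating sign. *)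
Lemma iter_opA (n : nat) (x : R) :
  Nat.iter n opA (fun y => exp (- y)) x =
  (-1) ^ n * exp_poly (fun k => (-1) ^ k * IZR (cosh_coef n k)) n x.
Proof.
  revert x; induction n as [|n IH]; intros x.
  - unfold exp_poly; simpl; ring.
  - change (Nat.iter (S n) opA (fun y => exp (- y)))
      with (opA (Nat.iter n opA (fun y => exp (- y)))).
    rewrite (opA_ext _ (exp_poly (fun k => (-1) ^ n * ((-1) ^ k * IZR (cosh_coef n k))) n)).
    2:{ intros y; rewrite IH; unfold exp_poly.
        rewrite <- Rmult_assoc, scal_sum; f_equal; apply sum_eq; intros; ring. }
    rewrite opA_exp_poly; unfold exp_poly; rewrite <- Rmult_assoc; f_equal.
    (* The recurrence shifts the index by one, so two sums cut at the same N
       differ by a single boundary term, which at N = n is the top coefficient. *)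
    assert (H : forall N, sum_f_R0 (fun k => (-1) ^ n * ((-1) ^ k * IZR (cosh_coef n k)) *
        ((2 * INR k + 1) * x ^ S k - INR k ^ 2 * x ^ k)) N =
      (-1) ^ S n * sum_f_R0 (fun k => (-1) ^ k * IZR (cosh_coef (S n) k) * x ^ k) N
      + (-1) ^ n * ((-1) ^ N * IZR (cosh_coef n N)) * (2 * INR N + 1) * x ^ S N).
    { induction N as [|N IHN].
      - simpl; ring.
      - rewrite !tech5, IHN, cosh_coef_S.
        rewrite <- !tech_pow_Rmult; ring. }
    rewrite H, tech5, cosh_coef_S, (cosh_coef_gt n (S n)) by lia.
    rewrite <- !tech_pow_Rmult; ring.
Qed.

Lemma p_eq_sum (n : nat) (x : R) :
  p n x = sum_f_R0 (fun k => (-1) ^ k * IZR (cosh_coef n k) * x ^ k) n.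
Proof.
  unfold p; rewrite iter_opA; unfold exp_poly.
  replace ((-1) ^ n * exp x * ((-1) ^ n *
    (sum_f_R0 (fun k => (-1) ^ k * IZR (cosh_coef n k) * x ^ k) n * exp (- x))))
   with (((-1) * (-1)) ^ n * (exp x * exp (- x)) *
    sum_f_R0 (fun k => (-1) ^ k * IZR (cosh_coef n k) * x ^ k) n)
   by (rewrite Rpow_mult_distr; ring).
  rewrite <- exp_plus, Rplus_opp_r, exp_0.
  replace (-1 * -1) with 1 by ring; rewrite pow1; ring.
Qed.

(** * The hyperbolic majorant *)

Lemma nonneg_of_derive (f f' : R -> R) :
  (forall t, is_derive f t (f' t)) -> 0 <= f 0 -> (forall t, 0 <= t -> 0 <= f' t) ->
  forall t, 0 <= t -> 0 <= f t.
Proof.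
  intros Hd H0 Hp t Ht.
  destruct (MVT_gen f 0 t f') as [c [Hc E]].
  - intros; apply Hd.
  - intros; apply continuity_pt_filterlim,
      (ex_derive_continuous (K := R_AbsRing) (V := R_NormedModule)).
    eexists; apply Hd.
  - rewrite Rmin_left, Rmax_right in Hc by trivial.
    pose proof (Rmult_le_pos _ _ (Hp c (proj1 Hc)) Ht). lra.
Qed.

Lemma nonneg_of_derive2 (f f' f'' : R -> R) :
  (forall t, is_derive f t (f' t)) -> (forall t, is_derive f' t (f'' t)) ->
  0 <= f 0 -> 0 <= f' 0 -> (forall t, 0 <= t -> 0 <= f'' t) ->
  forall t, 0 <= t -> 0 <= f t.
Proof.
  intros D1 D2 H0 H1 H2. apply (nonneg_of_derive f f'); trivial.
  apply (nonneg_of_derive f' f''); trivial.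
Qed.

Lemma is_derive_cosh (t : R) : is_derive cosh t (sinh t).
Proof. apply is_derive_Reals, derivable_pt_lim_cosh. Qed.

Lemma is_derive_sinh (t : R) : is_derive sinh t (cosh t).
Proof. apply is_derive_Reals, derivable_pt_lim_sinh. Qed.

Lemma sinh_sqr (t : R) : sinh t ^ 2 = (cosh t - 1) * (cosh t + 1).
Proof.
  unfold sinh, cosh. assert (exp t * exp (- t) = 1)
    by (rewrite <- exp_plus, Rplus_opp_r; apply exp_0). nra.
Qed.

Lemma cosh_ge1 (t : R) : 1 <= cosh t.
Proof.
  unfold cosh; pose proof (exp_ineq1_le t); pose proof (exp_ineq1_le (- t)); lra.
Qed.

Definition coshm1_divpow (k : nat) (u : R) : R := (cosh u - 1) ^ k / INR (fact k).

Lemma coshm1_divpow_ge0 (k : nat) (u : R) : 0 <= coshm1_divpow k u.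
Proof.
  apply Rdiv_le_0_compat; [|apply INR_fact_lt_0].
  apply pow_le. pose proof (cosh_ge1 u); lra.
Qed.

Lemma is_derive_coshm1_divpow (j : nat) (u : R) :
  is_derive (coshm1_divpow (S j)) u (sinh u * coshm1_divpow j u).
Proof.
  unfold coshm1_divpow.
  apply is_derive_ext with (f := fun t => / INR (fact (S j)) * (cosh t - 1) ^ S j);
    [intros t; apply Rmult_comm|].
  pose proof (INR_fact_neq_0 j).
  assert (INR j + 1 <> 0) by (pose proof (pos_INR j); lra).
  auto_derive; [split; trivial; eexists; apply is_derive_cosh|].
  replace (Derive (fun y => cosh y) u) with (sinh u)
    by (symmetry; apply is_derive_unique, is_derive_cosh).
  change (match j with O => 1 | S _ => INR j + 1 end) with (INR (S j)).
  change (fact j + j * fact j)%nat with (S j * fact j)%nat.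
  rewrite mult_INR, S_INR; change (cosh u + - (1)) with (cosh u - 1).
  generalize ((cosh u - 1) ^ j); intros; field; auto.
Qed.

Lemma is_derive2_coshm1_divpow (j : nat) (u : R) :
  is_derive (fun t => sinh t * coshm1_divpow j t) u
    (INR (S j) ^ 2 * coshm1_divpow (S j) u + (2 * INR j + 1) * coshm1_divpow j u).
Proof.
  assert (E : INR (S j) ^ 2 * coshm1_divpow (S j) u =
     (INR j + 1) * (cosh u - 1) * coshm1_divpow j u).
  { unfold coshm1_divpow. pose proof (INR_fact_neq_0 j).
    assert (INR j + 1 <> 0) by (pose proof (pos_INR j); lra).
    change (fact (S j)) with (S j * fact j)%nat.
    rewrite mult_INR, S_INR; simpl pow; field; auto. }
  rewrite E. destruct j as [|j].
  - apply is_derive_ext with (f := sinh).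
    { intros t; symmetry; unfold coshm1_divpow; simpl.
      rewrite Rdiv_1_r; apply Rmult_1_r. }
    replace (_ + _) with (cosh u) by (unfold coshm1_divpow; simpl; field).
    apply is_derive_sinh.
  - replace ((INR (S j) + 1) * (cosh u - 1) * coshm1_divpow (S j) u +
      (2 * INR (S j) + 1) * coshm1_divpow (S j) u) with
     (cosh u * coshm1_divpow (S j) u + sinh u * (sinh u * coshm1_divpow j u)).
    + apply (is_derive_mult (K := R_AbsRing) sinh (coshm1_divpow (S j)) u);
        [apply is_derive_sinh|apply is_derive_coshm1_divpow|intros; apply Rmult_comm].
    + replace (sinh u * (sinh u * coshm1_divpow j u)) with (sinh u ^ 2 * coshm1_divpow j u) by ring.
      rewrite sinh_sqr. unfold coshm1_divpow. pose proof (INR_fact_neq_0 j).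
      assert (INR j + 1 <> 0) by (pose proof (pos_INR j); lra).
      change (fact (S j)) with (S j * fact j)%nat.
      rewrite mult_INR, S_INR; simpl pow; field; auto.
Qed.

Lemma is_derive_divided_power (c : R) (m : nat) (u : R) :
  is_derive (fun t => c * (t ^ S m / INR (fact (S m)))) u (c * (u ^ m / INR (fact m))).
Proof.
  pose proof (INR_fact_neq_0 m).
  assert (INR m + 1 <> 0) by (pose proof (pos_INR m); lra).
  apply is_derive_ext with (f := fun t => c * (/ INR (fact (S m)) * t ^ S m));
    [intros t; f_equal; apply Rmult_comm|].
  auto_derive; trivial.
  change (match m with O => 1 | S _ => INR m + 1 end) with (INR (S m)).
  change (fact m + m * fact m)%nat with (S m * fact m)%nat.
  rewrite mult_INR, S_INR; field; auto.
Qed.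

(** Nonnegativity of all Taylor coefficients of [(cosh u - 1)^k / k!] would
    give this at once; comparing second derivatives instead turns the recurrence
    into an induction on [n] that needs no power series. *)
Lemma cosh_coef_le (n k : nat) (u : R) : 0 <= u ->
  IZR (cosh_coef n k) * (u ^ (2 * n) / INR (fact (2 * n))) <= coshm1_divpow k u.
Proof.
  revert k u; induction n as [|n IH]; intros [|j] u Hu.
  - unfold coshm1_divpow; simpl; lra.
  - simpl; rewrite Rmult_0_l; apply coshm1_divpow_ge0.
  - change (cosh_coef (S n) 0) with 0%Z; rewrite Rmult_0_l; apply coshm1_divpow_ge0.
  - set (c := IZR (cosh_coef (S n) (S j))).
    replace (2 * S n)%nat with (S (S (2 * n))) by lia.
    cut (0 <= coshm1_divpow (S j) u - c * (u ^ S (S (2 * n)) / INR (fact (S (S (2 * n))))));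
      [lra|].
    revert u Hu.
    apply (nonneg_of_derive2
      (fun u => coshm1_divpow (S j) u - c * (u ^ S (S (2 * n)) / INR (fact (S (S (2 * n))))))
      (fun u => sinh u * coshm1_divpow j u - c * (u ^ S (2 * n) / INR (fact (S (2 * n)))))
      (fun u => INR (S j) ^ 2 * coshm1_divpow (S j) u + (2 * INR j + 1) * coshm1_divpow j u
         - c * (u ^ (2 * n) / INR (fact (2 * n))))).
    + intros t; apply (is_derive_minus (V := R_NormedModule));
        [apply is_derive_coshm1_divpow|apply is_derive_divided_power].
    + intros t; apply (is_derive_minus (V := R_NormedModule));
        [apply is_derive2_coshm1_divpow|apply is_derive_divided_power].
    + rewrite pow_i by lia. pose proof (coshm1_divpow_ge0 (S j) 0). unfold Rdiv; lra.
    + rewrite pow_i by lia. rewrite sinh_0. unfold Rdiv; lra.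
    + intros t Ht. unfold c; rewrite cosh_coef_S.
      pose proof (IH (S j) t Ht) as H1. pose proof (IH j t Ht) as H2.
      apply (Rmult_le_compat_l (INR (S j) ^ 2)) in H1; [|apply pow2_ge_0].
      apply (Rmult_le_compat_l (2 * INR j + 1)) in H2; [|pose proof (pos_INR j); lra].
      lra.
Qed.

Lemma exp_le_compat (a b : R) : a <= b -> exp a <= exp b.
Proof. intros [H | ->]; [left; apply exp_increasing; trivial|right; reflexivity]. Qed.

(** The terms on the left are twice those of [cosh X] or of [sinh X], according
    to the sign [s], so every partial sum is below the full series. *)
Lemma sum_exp_le (s X : R) (N : nat) : s = 1 \/ s = -1 -> 0 <= X ->
  sum_f_R0 (fun k => (1 + s * (-1) ^ k) * (X ^ k / INR (fact k))) N
    <= exp X + s * exp (- X).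
Proof.
  intros Hs HX.
  assert (H : is_series (fun k => (1 + s * (-1) ^ k) * (X ^ k / INR (fact k)))
     (exp X + s * exp (- X))).
  { apply is_series_ext with
      (fun k => plus (scal (X ^ k) (/ INR (fact k)))
                     (scal s (scal ((- X) ^ k) (/ INR (fact k))))).
    { intros k. unfold plus, scal; simpl; unfold mult; simpl.
      replace (- X) with (-1 * X) by ring. rewrite Rpow_mult_distr.
      unfold Rdiv; ring. }
    apply (is_series_plus (V := R_NormedModule)).
    - generalize (is_exp_Reals X); unfold is_pseries; apply is_series_ext.
      intros k; rewrite pow_n_pow; reflexivity.
    - apply (is_series_scal (V := R_NormedModule)).
      generalize (is_exp_Reals (- X)); unfold is_pseries; apply is_series_ext.
      intros k; rewrite pow_n_pow; reflexivity. }
  apply is_series_Reals in H.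
  apply (sum_incr _ N _ H).
  intros k. apply Rmult_le_pos.
  - destruct (Nat.Even_or_Odd k) as [[m ->]|[m ->]].
    + rewrite pow_1_even; destruct Hs; subst; lra.
    + replace (2 * m + 1)%nat with (S (2 * m)) by lia.
      rewrite pow_1_odd; destruct Hs; subst; lra.
  - apply Rdiv_le_0_compat; [apply pow_le; trivial|apply INR_fact_lt_0].
Qed.

Lemma pow_m1_sign (k : nat) : (-1) ^ k = 1 \/ (-1) ^ k = -1.
Proof.
  destruct (Nat.Even_or_Odd k) as [[m ->]|[m ->]].
  - left; apply pow_1_even.
  - right; replace (2 * m + 1)%nat with (S (2 * m)) by lia; apply pow_1_odd.
Qed.

(** The terms of one parity alone bound the sum from above and those of the
    other from below.  The odd terms contribute at most [M sinh X]; the even ones at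
    most [M (cosh X - 1)], where the vanishing of [t 0] removes the constant that
    would spoil the factor [1/2]. *)
Lemma alternating_sum_le (t : nat -> R) (M X : R) (N : nat) :
  0 <= M -> 0 <= X -> t O = 0 ->
  (forall k, 0 <= t k <= M * (X ^ k / INR (fact k))) ->
  Rabs (sum_f_R0 (fun k => (-1) ^ k * t k) N) <= M * (exp X / 2).
Proof.
  intros HM HX H0 Ht.
  pose proof (sum_exp_le 1 X N (or_introl eq_refl) HX) as HE.
  pose proof (sum_exp_le (-1) X N (or_intror eq_refl) HX) as HO.
  pose proof (exp_pos (- X)).
  assert (exp (- X) <= 1) by (rewrite <- exp_0; apply exp_le_compat; lra).
  assert (L1 : sum_f_R0 (fun k => (-1) ^ k * t k) N <=
     M / 2 * (sum_f_R0 (fun k => (1 + 1 * (-1) ^ k) * (X ^ k / INR (fact k))) N - 2)).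
  { clear HE HO; induction N as [|N IH].
    - simpl; rewrite H0; lra.
    - rewrite !tech5.
      destruct (Ht (S N)), (pow_m1_sign (S N)) as [-> | ->]; lra. }
  assert (L2 : - (M / 2 * sum_f_R0 (fun k => (1 + -1 * (-1) ^ k) * (X ^ k / INR (fact k))) N)
     <= sum_f_R0 (fun k => (-1) ^ k * t k) N).
  { clear HE HO L1; induction N as [|N IH].
    - simpl; rewrite H0; lra.
    - rewrite !tech5.
      destruct (Ht (S N)), (pow_m1_sign (S N)) as [-> | ->]; lra. }
  apply (Rmult_le_compat_l (M / 2)) in HE; [|lra].
  apply (Rmult_le_compat_l (M / 2)) in HO; [|lra].
  assert (0 <= M * (1 - exp (- X))) by (apply Rmult_le_pos; lra).
  assert (0 <= M * exp (- X)) by (apply Rmult_le_pos; lra).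
  apply Rabs_le; split; lra.
Qed.

(** The comparison is term by term, with [X = x (cosh rho - 1)].  The constant
    term of [p n] vanishes because [n >= 1]. *)
Lemma p_le_majorant (n : nat) (x rho eps : R) :
  (1 <= n)%nat -> 0 < x -> 0 < rho -> cosh rho - 1 <= eps ->
  Rabs (p n x) <= INR (fact (2 * n)) / rho ^ (2 * n) * (exp (eps * x) / 2).
Proof.
  intros Hn Hx Hr He.
  pose proof (INR_fact_lt_0 (2 * n)) as Hf.
  pose proof (pow_lt rho (2 * n) Hr) as Hp.
  pose proof (cosh_ge1 rho).
  assert (HM : 0 < INR (fact (2 * n)) / rho ^ (2 * n)) by (apply Rdiv_lt_0_compat; trivial).
  apply Rle_trans with
    (INR (fact (2 * n)) / rho ^ (2 * n) * (exp (x * (cosh rho - 1)) / 2)).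
  - rewrite p_eq_sum.
    rewrite (sum_eq _ (fun k => (-1) ^ k * (IZR (cosh_coef n k) * x ^ k)))
      by (intros; ring).
    apply alternating_sum_le.
    + lra.
    + apply Rmult_le_pos; lra.
    + destruct n; [lia|]. simpl; ring.
    + intros k. pose proof (cosh_coef_ge0 n k). pose proof (pow_lt x k Hx).
      split; [apply Rmult_le_pos; lra|].
      pose proof (cosh_coef_le n k rho (Rlt_le _ _ Hr)) as Hc.
      unfold coshm1_divpow in Hc.
      apply (Rmult_le_compat_l (INR (fact (2 * n)) / rho ^ (2 * n) * x ^ k)) in Hc;
        [|apply Rmult_le_pos; lra].
      rewrite Rpow_mult_distr.
      pose proof (INR_fact_neq_0 k).
      replace (IZR (cosh_coef n k) * x ^ k) with
        (INR (fact (2 * n)) / rho ^ (2 * n) * x ^ k *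
         (IZR (cosh_coef n k) * (rho ^ (2 * n) / INR (fact (2 * n))))) by (field; lra).
      eapply Rle_trans; [exact Hc|]. right; field. split; lra.
  - apply Rmult_le_compat_l; [lra|].
    assert (exp (x * (cosh rho - 1)) <= exp (eps * x)) by (apply exp_le_compat; nra). lra.
Qed.

(** * Elementary numerical inequalities *)

Lemma cos_le_taylor (a : R) : 0 <= a <= 2 ->
  cos a <= 1 - a ^ 2 / 2 + a ^ 4 / 24 - a ^ 6 / 720 + a ^ 8 / 40320.
Proof.
  intros Ha. destruct (pre_cos_bound a 1) as [_ H]; try lra.
  unfold cos_approx, cos_term in H.
  cbn [sum_f_R0 Nat.mul Nat.add] in H. rewrite !INR_IZR_INZ in H.
  vm_compute (Z.of_nat _) in H. simpl pow in *. lra.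
Qed.

Lemma sin_ge_taylor (a : R) : 0 <= a <= 4 ->
  a - a ^ 3 / 6 + a ^ 5 / 120 - a ^ 7 / 5040 <= sin a.
Proof.
  intros Ha. destruct (pre_sin_bound a 1) as [H _]; try lra.
  unfold sin_approx, sin_term in H.
  cbn [sum_f_R0 Nat.mul Nat.add] in H. rewrite !INR_IZR_INZ in H.
  vm_compute (Z.of_nat _) in H. simpl pow in *. lra.
Qed.

(** If [PI / 2] exceeded [63/40], the cosine there would be nonnegative, but
    its Taylor bound is negative. *)
Lemma PI_le : PI <= 63 / 20.
Proof.
  destruct (Rle_or_lt PI (63 / 20)) as [|H]; trivial. exfalso.
  pose proof (cos_le_taylor (63 / 40)).
  assert (0 <= cos (63 / 40)) by (apply cos_ge_0; lra). lra.
Qed.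

Lemma le_of_cos_ge_half (r : R) : 0 <= r <= PI -> 1 / 2 <= cos r -> r <= 21 / 20.
Proof.
  intros Hr Hc. destruct (Rle_or_lt r (21 / 20)) as [|H]; trivial. exfalso.
  pose proof (cos_le_taylor (21 / 20)).
  assert (cos r < cos (21 / 20)) by (apply cos_decreasing_1; lra). lra.
Qed.

Lemma sin_ge_mul (r : R) : 0 <= r <= 4 ->
  r * (1 - r ^ 2 / 6 + (r ^ 2) ^ 2 / 120 - (r ^ 2) ^ 3 / 5040) <= sin r.
Proof.
  intros Hr; eapply Rle_trans; [|apply (sin_ge_taylor r Hr)]. right; field.
Qed.

Lemma sin_ge_linear (r : R) : 0 <= r <= 21 / 20 -> 41 / 50 * r <= sin r.
Proof.
  intros Hr. pose proof (sin_ge_mul r ltac:(lra)) as H.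
  assert (Hw : 0 <= r ^ 2 <= 441 / 400) by nra.
  revert H Hw; generalize (r ^ 2); intros w H Hw.
  assert (41 / 50 <= 1 - w / 6 + w ^ 2 / 120 - w ^ 3 / 5040).
  { assert (0 <= w * w * (42 - w)) by (apply Rmult_le_pos; nra). nra. }
  nra.
Qed.

(** The bound is the Taylor polynomial of [sin^2], written in
    [r^2]; it comes from squaring the Taylor bound for [sin] and dropping a
    positive remainder. *)
Lemma sin_sqr_ge (r : R) : 0 <= r <= 21 / 20 ->
  r ^ 2 - (r ^ 2) ^ 2 / 3 + 2 * (r ^ 2) ^ 3 / 45 - (r ^ 2) ^ 4 / 315 <= sin r ^ 2.
Proof.
  intros Hr. pose proof (sin_ge_mul r ltac:(lra)) as H.
  assert (Hw : 0 <= r ^ 2 <= 441 / 400) by nra.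
  assert (Hr2 : r * r = r ^ 2) by ring.
  revert H Hw Hr2; generalize (r ^ 2); intros w H Hw Hr2.
  set (q := 1 - w / 6 + w ^ 2 / 120 - w ^ 3 / 5040) in *.
  assert (0 <= q).
  { unfold q. assert (0 <= w * w * (42 - w)) by (apply Rmult_le_pos; nra). nra. }
  assert (w * q ^ 2 <= sin r ^ 2).
  { replace (w * q ^ 2) with ((r * q) ^ 2) by (rewrite <- Hr2; ring).
    apply pow_incr; split; trivial. apply Rmult_le_pos; lra. }
  assert (E : w * q ^ 2 = w - w ^ 2 / 3 + 2 * w ^ 3 / 45 - w ^ 4 / 315
     + w ^ 5 * (1 / 14400 + 1 / 15120 - w / 302400 + w ^ 2 / 25401600)).
  { unfold q; field. }
  assert (0 <= w ^ 5 * (1 / 14400 + 1 / 15120 - w / 302400 + w ^ 2 / 25401600))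
    by (apply Rmult_le_pos; [apply pow_le; lra|nra]).
  lra.
Qed.

Lemma cosh_le_cosh_double (t : R) : 0 <= t -> cosh t <= cosh (2 * t).
Proof.
  intros Ht. replace (2 * t) with (t + t) by ring. unfold cosh.
  rewrite Ropp_plus_distr, !exp_plus.
  assert (exp t * exp (- t) = 1) by (rewrite <- exp_plus, Rplus_opp_r; apply exp_0).
  pose proof (exp_ineq1_le t); pose proof (exp_ineq1_le (- t)). nra.
Qed.

Lemma cosh_double (t : R) : cosh (2 * t) = 2 * cosh t ^ 2 - 1.
Proof.
  replace (2 * t) with (t + t) by ring. unfold cosh.
  rewrite Ropp_plus_distr, !exp_plus.
  assert (exp t * exp (- t) = 1) by (rewrite <- exp_plus, Rplus_opp_r; apply exp_0).
  lra.
Qed.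

(** With [y = cosh rho - 1] the left side is [2 y - y^2], the expression in
    [eps] that bounds [sin r ^ 2 + 1/4].  It equals
    [4 cosh rho - cosh (2 rho) / 2 - 7 / 2], whose Taylor coefficients in degree
    at least [4] are all negative, so any truncation is an upper bound.
    After six derivatives the claim reads
    [4 cosh rho + 28 <= 32 cosh (2 rho)]. *)
Lemma cosh_quadratic_le (rho : R) : 0 <= rho ->
  1 - (2 - cosh rho) ^ 2 <= rho ^ 2 - rho ^ 4 / 6 - 7 * rho ^ 6 / 180.
Proof.
  assert (C0 : cosh 0 = 1) by (apply cosh_0). assert (S0 : sinh 0 = 0) by (apply sinh_0).
  assert (H4 : forall t, 0 <= t -> 0 <= - 4 - 14 * t ^ 2 - 4 * cosh t + 8 * cosh (2 * t)).
  { apply (nonneg_of_derive2 _ (fun t => - 28 * t - 4 * sinh t + 16 * sinh (2 * t))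
       (fun t => - 28 - 4 * cosh t + 32 * cosh (2 * t))).
    - intros t. unfold sinh, cosh; auto_derive; trivial; field.
    - intros t. unfold sinh, cosh; auto_derive; trivial; field.
    - rewrite !Rmult_0_r, C0; lra.
    - rewrite !Rmult_0_r, S0; lra.
    - intros t Ht; pose proof (cosh_le_cosh_double t Ht); pose proof (cosh_ge1 t); lra. }
  assert (H2 : forall t, 0 <= t ->
     0 <= 2 - 2 * t ^ 2 - 7 * t ^ 4 / 6 - 4 * cosh t + 2 * cosh (2 * t)).
  { apply (nonneg_of_derive2 _ (fun t => - 4 * t - 14 * t ^ 3 / 3 - 4 * sinh t + 4 * sinh (2 * t))
       (fun t => - 4 - 14 * t ^ 2 - 4 * cosh t + 8 * cosh (2 * t))); trivial.
    - intros t. unfold sinh, cosh; auto_derive; trivial; field.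
    - intros t. unfold sinh, cosh; auto_derive; trivial; field.
    - rewrite !Rmult_0_r, C0; lra.
    - rewrite !Rmult_0_r, S0; lra. }
  assert (H0 : forall t, 0 <= t ->
     0 <= t ^ 2 - t ^ 4 / 6 - 7 * t ^ 6 / 180 + 7 / 2 - 4 * cosh t + cosh (2 * t) / 2).
  { apply (nonneg_of_derive2 _
       (fun t => 2 * t - 2 * t ^ 3 / 3 - 7 * t ^ 5 / 30 - 4 * sinh t + sinh (2 * t))
       (fun t => 2 - 2 * t ^ 2 - 7 * t ^ 4 / 6 - 4 * cosh t + 2 * cosh (2 * t))); trivial.
    - intros t. unfold sinh, cosh; auto_derive; trivial; field.
    - intros t. unfold sinh, cosh; auto_derive; trivial; field.
    - rewrite !Rmult_0_r, C0; lra.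
    - rewrite !Rmult_0_r, S0; lra. }
  intros Hr; specialize (H0 rho Hr). rewrite cosh_double in H0. lra.
Qed.

Lemma exp_mult_INR (n : nat) (y : R) : exp (INR n * y) = exp y ^ n.
Proof.
  induction n as [|n IH].
  - simpl; rewrite Rmult_0_l, exp_0; reflexivity.
  - replace (INR (S n) * y) with (y + INR n * y) by (rewrite S_INR; ring).
    rewrite exp_plus, IH; reflexivity.
Qed.

Lemma cosh_le_2 (rho : R) : 0 <= rho <= 121 / 100 -> cosh rho <= 2.
Proof.
  intros Hr.
  (* On t = exp (- rho) the claim reads t + 1 / t <= 4, which holds from
     2 - sqrt 3 = 0.268 up to 1. *)
  assert (H : 28 / 100 <= exp (- rho)).
  { replace (- rho) with (INR 16 * (- rho / 16)) by (simpl; field).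
    rewrite exp_mult_INR. pose proof (exp_ineq1_le (- rho / 16)).
    apply Rle_trans with ((1 - 121 / 100 / 16) ^ 16); [lra|apply pow_incr; lra]. }
  assert (exp (- rho) <= 1) by (rewrite <- exp_0; apply exp_le_compat; lra).
  assert (exp rho * exp (- rho) = 1) by (rewrite <- exp_plus, Rplus_opp_r; apply exp_0).
  pose proof (exp_pos rho).
  unfold cosh. nra.
Qed.

(** The map [e -> 2 e - e^2] increases on [e <= 1].  Were
    [y = cosh rho - 1] larger than [eps], then
    [sin r ^ 2 <= 2 y - y^2 - 1/4], and the two Taylor bounds above contradict
    this: in [w = r^2] they reduce to a polynomial inequality.  The
    radius [rho^2 = 1/4 + 27/25 w] is a linear lower bound, over the range of [w],
    for [arccosh (1 + eps)^2] at the least [eps] that the constraint allows. *)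
Lemma cosh_radius_le (r eps : R) : 0 <= r <= 21 / 20 -> eps <= 1 ->
  sin r ^ 2 <= 2 * eps - eps ^ 2 - 1 / 4 ->
  cosh (sqrt (1 / 4 + 27 / 25 * r ^ 2)) - 1 <= eps.
Proof.
  intros Hr He Hs.
  pose proof (sin_sqr_ge r Hr) as Hsin.
  assert (Hw : 0 <= r ^ 2 <= 441 / 400) by nra.
  revert Hsin Hw; generalize (r ^ 2); intros w Hsin Hw.
  assert (Hrho : 0 <= sqrt (1 / 4 + 27 / 25 * w)) by apply sqrt_pos.
  assert (Hsq : sqrt (1 / 4 + 27 / 25 * w) ^ 2 = 1 / 4 + 27 / 25 * w)
    by (apply pow2_sqrt; lra).
  revert Hrho Hsq; generalize (sqrt (1 / 4 + 27 / 25 * w)); intros rho Hrho Hsq.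
  pose proof (cosh_le_2 rho ltac:(nra)) as H2.
  pose proof (cosh_quadratic_le rho Hrho) as Hc.
  replace (rho ^ 4) with ((rho ^ 2) ^ 2) in Hc by ring.
  replace (rho ^ 6) with ((rho ^ 2) ^ 3) in Hc by ring.
  rewrite Hsq in Hc.
  assert (Hpoly : (1 / 4 + 27 / 25 * w) - (1 / 4 + 27 / 25 * w) ^ 2 / 6
      - 7 * (1 / 4 + 27 / 25 * w) ^ 3 / 180 - 1 / 4
     < w - w ^ 2 / 3 + 2 * w ^ 3 / 45 - w ^ 4 / 315).
  { clear - Hw.
    (* The slack is least near w = 17/25. *)
    assert (0 <= w * (w - 17 / 25) ^ 2) by (apply Rmult_le_pos; [lra|apply pow2_ge_0]).
    assert (0 <= w ^ 3 * (441 / 400 - w)) by (apply Rmult_le_pos; [apply pow_le|]; lra).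
    nra. }
  destruct (Rle_or_lt (cosh rho - 1) eps) as [|Hlt]; trivial; exfalso. nra.
Qed.

(** * Reduction to a bound without PI *)

(** Factorials up to [32!] have to be evaluated, which binary integers
    allow and unary ones do not. *)
Fixpoint Zfact (n : nat) : Z :=
  match n with O => 1 | S m => Z.of_nat n * Zfact m end%Z.

Lemma INR_fact_Z (n : nat) : INR (fact n) = IZR (Zfact n).
Proof.
  induction n as [|n IH]; [reflexivity|].
  change (Zfact (S n)) with (Z.of_nat (S n) * Zfact n)%Z.
  change (fact (S n)) with (S n * fact n)%nat.
  rewrite mult_INR, mult_IZR, IH, INR_IZR_INZ; reflexivity.
Qed.

Lemma INR_fact_SS (n : nat) :
  INR (fact (S (S n))) = (INR n + 2) * (INR n + 1) * INR (fact n).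
Proof.
  change (fact (S (S n))) with (S (S n) * (S n * fact n))%nat.
  rewrite !mult_INR, !S_INR; ring.
Qed.

Lemma pow4_2n (a : R) (n : nat) : (a ^ 2) ^ (2 * n) = a ^ (4 * n).
Proof. rewrite <- pow_mult; f_equal; lia. Qed.

(** A sufficient condition for the claim with [alpha = 2 r]: [63/20] replaces
    [PI], [4] replaces the quotient [(2^(4n) - 1) / (2^(4n-2) + 6 / PI^2 - 1)],
    and [(2r)^(4n)] is written [16^n (r^2)^(2n)]. *)
Definition strong_bound (n : nat) (x r eps : R) : Prop :=
  exists M, 0 <= M /\ Rabs (p n x) <= M * (exp (eps * x) / 2) /\
  M ^ 2 * (63 / 20 * INR n * 16 ^ n * (r ^ 2) ^ (2 * n))
    <= 4 * INR (fact (4 * n)) * sin r.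

(** Since [PI > 3] gives [6 / PI^2 <= 3/4], four times the last factor of the
    denominator is at most [2^(4n) - 1]. *)
Lemma bound_of_strong_bound (n : nat) (x r eps : R) :
  (1 <= n)%nat -> 0 < r -> strong_bound n x r eps ->
  Rabs (p n x) <= sqrt ((2 ^ (4 * n) - 1) * INR (fact (4 * n)) * sin r /
          (PI * INR n * (2 * r) ^ (4 * n) * (2 ^ (4 * n - 2) + 6 / PI ^ 2 - 1)))
    * (exp (eps * x) / 2).
Proof.
  intros Hn Hr [M [HM [HP H]]].
  apply Rle_trans with (M * (exp (eps * x) / 2)); trivial.
  apply Rmult_le_compat_r; [pose proof (exp_pos (eps * x)); lra|].
  rewrite <- (sqrt_pow2 M) by trivial. apply sqrt_le_1_alt.
  assert (HPI : 3 < PI) by (pose proof PI2_3_2; unfold PI2 in *; lra).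
  pose proof PI_le.
  assert (Hn' : 1 <= INR n) by (apply (le_INR 1); trivial).
  assert (H2 : 1 <= 2 ^ (4 * n - 2)) by (apply pow_R1_Rle; lra).
  assert (E4 : 2 ^ (4 * n) = 4 * 2 ^ (4 * n - 2)).
  { replace (4 * n)%nat with (S (S (4 * n - 2))) at 1 by lia. simpl pow; ring. }
  rewrite E4, Rpow_mult_distr, E4, pow4_2n in *.
  assert (E16 : 16 ^ n = 4 * 2 ^ (4 * n - 2)).
  { rewrite <- E4, pow_mult; f_equal; ring. }
  rewrite E16 in H.
  set (t := 2 ^ (4 * n - 2)) in *.
  assert (HQ : 0 < 6 / PI ^ 2 <= 3 / 4).
  { split; [apply Rdiv_lt_0_compat; [lra|apply pow_lt; lra]|].
    apply (fun H => proj2 (Rle_div_l _ _ _ H)); [apply pow_lt; lra|nra]. }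
  set (Q := 6 / PI ^ 2) in *.
  assert (Hp : 0 < r ^ (4 * n)) by (apply pow_lt; trivial).
  set (F := INR (fact (4 * n)) * sin r).
  assert (HF : M ^ 2 * (PI * INR n * (4 * t * r ^ (4 * n))) <= 4 * F).
  { unfold F; rewrite <- (Rmult_assoc 4); eapply Rle_trans; [|exact H].
    apply Rmult_le_compat_l; [apply pow2_ge_0|].
    replace (63 / 20 * INR n * (4 * t) * r ^ (4 * n))
      with (63 / 20 * INR n * (4 * t * r ^ (4 * n))) by ring.
    apply Rmult_le_compat_r; [apply Rmult_le_pos; lra|].
    apply Rmult_le_compat_r; lra. }
  assert (0 <= F).
  { assert (0 <= M ^ 2 * (PI * INR n * (4 * t * r ^ (4 * n)))); [|lra].
    apply Rmult_le_pos; [apply pow2_ge_0|]. apply Rmult_le_pos; apply Rmult_le_pos; lra. }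
  apply (fun H => proj1 (Rle_div_r _ _ _ H)).
  { apply Rmult_lt_0_compat; [|lra]. apply Rmult_lt_0_compat; apply Rmult_lt_0_compat; lra. }
  replace ((4 * t - 1) * INR (fact (4 * n)) * sin r) with ((4 * t - 1) * F)
    by (unfold F; ring).
  replace (M ^ 2 * (PI * INR n * (4 * t * r ^ (4 * n)) * (t + Q - 1)))
    with (M ^ 2 * (PI * INR n * (4 * t * r ^ (4 * n))) * (t + Q - 1)) by ring.
  apply Rle_trans with (4 * F * (t + Q - 1)).
  - apply Rmult_le_compat_r; lra.
  - assert (0 <= F * (3 - 4 * Q)) by (apply Rmult_le_pos; lra). lra.
Qed.

(** * Large n: the majorant *)

(** Dividing by [(2n)!^2 16^n], this compares [n z^(2n)] with
    [binomial(4n, 2n) / 16^n].  From [n] to [n + 1] the ratio of the two sides is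
    multiplied by [4 z^2 (n + 1) (2n + 2) (2n + 1) / (n (4n + 3) (4n + 1))], which
    is below [1] here, so the case [n = 8] propagates. *)
Lemma ratio_pow_bound (n : nat) (z s : R) :
  (8 <= n)%nat -> 0 <= z -> z ^ 2 <= 3 / 5 ->
  INR (fact 16) ^ 2 * (63 / 20 * 8 * 16 ^ 8 * z ^ 16) <= 4 * INR (fact 32) * s ->
  INR (fact (2 * n)) ^ 2 * (63 / 20 * INR n * 16 ^ n * z ^ (2 * n))
    <= 4 * INR (fact (4 * n)) * s.
Proof.
  intros Hn Hz Hz2 H8. induction Hn as [|m Hm IH].
  - change (2 * 8)%nat with 16%nat; change (4 * 8)%nat with 32%nat.
    replace (INR 8) with 8 by (simpl; ring); exact H8.
  - replace (2 * S m)%nat with (S (S (2 * m))) by lia.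
    replace (4 * S m)%nat with (S (S (S (S (4 * m))))) by lia.
    rewrite !INR_fact_SS, !S_INR, !mult_INR, <- !tech_pow_Rmult.
    replace (INR 2) with 2 by reflexivity. replace (INR 4) with 4 by (simpl; ring).
    assert (Hm8 : 8 <= INR m) by (replace 8 with (INR 8) by (simpl; ring); apply le_INR; trivial).
    set (x := INR m) in *.
    set (L := INR (fact (2 * m)) ^ 2 * (63 / 20 * 16 ^ m * z ^ (2 * m))).
    assert (HL : 0 <= L).
    { apply Rmult_le_pos; [apply pow2_ge_0|].
      repeat apply Rmult_le_pos; try lra; apply pow_le; lra. }
    set (A := (2 * x + 2) * (2 * x + 1)). set (B := (4 * x + 3) * (4 * x + 1)).
    assert (HA : 0 <= A) by (unfold A; nra). assert (HB : 0 <= B) by (unfold B; nra).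
    assert (K : 4 * A * z ^ 2 * (x + 1) <= B * x).
    { apply Rle_trans with (4 * A * (3 / 5) * (x + 1)).
      - apply Rmult_le_compat_r; [lra|]. apply Rmult_le_compat_l; lra.
      - unfold A, B. nra. }
    apply (Rmult_le_compat_l (4 * A * L)) in K; [|apply Rmult_le_pos; lra].
    apply (Rmult_le_compat_l (4 * A * B)) in IH; [|apply Rmult_le_pos; lra].
    unfold L, A, B in *. lra.
Qed.

(** The power of [z = r^2 / rho^2] is compared with [sin r], which is small
    with [r].  One of the sixteen factors at [n = 8] is spent on this, as [z] is at most
    [r / 1.039] by the arithmetic-geometric mean; the others use the uniform bound
    [0.7655]. *)
Lemma large_n_case (n : nat) (x r eps : R) : (8 <= n)%nat -> 0 < x ->
  0 < r <= 21 / 20 -> eps <= 1 -> sin r ^ 2 <= 2 * eps - eps ^ 2 - 1 / 4 ->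
  strong_bound n x r eps.
Proof.
  intros Hn Hx Hr He Hs.
  pose proof (cosh_radius_le r eps ltac:(lra) He Hs) as Hc.
  assert (Hw : 0 <= r ^ 2 <= 441 / 400) by nra.
  set (w := r ^ 2) in *. set (R2 := 1 / 4 + 27 / 25 * w) in *.
  assert (HR : 0 < R2) by (unfold R2; lra).
  set (rho := sqrt R2) in *.
  assert (Hrho : 0 < rho) by (apply sqrt_lt_R0; trivial).
  assert (Hsq : rho ^ 2 = R2) by (apply pow2_sqrt; lra).
  exists (INR (fact (2 * n)) / rho ^ (2 * n)); split; [|split].
  - apply Rdiv_le_0_compat; [apply pos_INR|apply pow_lt; trivial].
  - apply p_le_majorant; trivial; lia.
  - fold w. assert (Hz : 0 <= w / R2) by (apply Rdiv_le_0_compat; lra).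
    replace ((INR (fact (2 * n)) / rho ^ (2 * n)) ^ 2 *
       (63 / 20 * INR n * 16 ^ n * w ^ (2 * n))) with
      (INR (fact (2 * n)) ^ 2 * (63 / 20 * INR n * 16 ^ n * (w / R2) ^ (2 * n))).
    2:{ assert (E : (w / R2) ^ (2 * n) = w ^ (2 * n) / (rho ^ (2 * n)) ^ 2).
        { unfold Rdiv; rewrite Rpow_mult_distr, pow_inv, <- Hsq, <- !pow_mult.
          do 3 f_equal; lia. }
        rewrite E; field. apply pow_nonzero; lra. }
    assert (Hz1 : w / R2 <= 7655 / 10000).
    { apply (fun H => proj2 (Rle_div_l _ _ _ H)); [trivial|unfold R2; lra]. }
    assert (Hz2 : w / R2 <= 1000 / 1039 * r).
    { apply (fun H => proj2 (Rle_div_l _ _ _ H)); [trivial|unfold R2, w].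
      (* The mean inequality for 1/4 + 27/25 r^2 is an equality at r near 0.481. *)
      pose proof (pow2_ge_0 (r - 481 / 1000)). nra. }
    revert Hz Hz1 Hz2; generalize (w / R2); intros z Hz Hz1 Hz2.
    apply ratio_pow_bound; trivial; [nra|].
    pose proof (sin_ge_linear r ltac:(lra)).
    assert (H15 : z ^ 15 <= (7655 / 10000) ^ 15) by (apply pow_incr; lra).
    assert (H16 : z ^ 16 <= 1000 / 1039 * r * (7655 / 10000) ^ 15).
    { change (z ^ 16) with (z * z ^ 15).
      apply Rmult_le_compat; trivial. apply pow_le; trivial. }
    rewrite !INR_fact_Z.
    let v := eval vm_compute in (Zfact 16) in change (Zfact 16) with v.
    let v := eval vm_compute in (Zfact 32) in change (Zfact 32) with v.
    clear - H H16 Hr. lra.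
Qed.

(** * Small n: one monomial at a time *)

Lemma exp_m1_le : exp (- (1)) <= 36792 / 100000.
Proof.
  pose proof (exp_pos 1).
  assert (H1 : 2718 / 1000 <= exp 1).
  { assert (Hser : is_series (fun k => scal (1 ^ k) (/ INR (fact k))) (exp 1)).
    { generalize (is_exp_Reals 1); unfold is_pseries; apply is_series_ext.
      intros k; rewrite pow_n_pow; reflexivity. }
    apply is_series_Reals in Hser.
    eapply Rle_trans; [|apply (sum_incr _ 7 _ Hser)].
    - unfold scal; simpl; unfold mult; simpl; lra.
    - intros k; unfold scal; simpl; unfold mult; simpl; rewrite pow1, Rmult_1_l.
      left; apply Rinv_0_lt_compat, INR_fact_lt_0. }
  rewrite exp_Ropp. apply Rle_trans with (/ (2718 / 1000)); [|lra].
  apply Rinv_le_contravar; lra.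
Qed.

(** From [y <= exp (y - 1)] at [y = eps x / k], raised to the power [k].  Using
    [eps^n] in place of [eps^k] puts all monomials of [p n] on the same scale. *)
Lemma pow_mul_le_exp (n k : nat) (x eps : R) :
  (1 <= k <= n)%nat -> 0 < x -> 0 < eps <= 1 ->
  x ^ k * eps ^ n <= (INR k * (36792 / 100000)) ^ k * exp (eps * x).
Proof.
  intros Hk Hx He.
  assert (HK : 0 < INR k) by (apply lt_0_INR; lia).
  apply Rle_trans with ((x * eps) ^ k).
  - rewrite Rpow_mult_distr. apply Rmult_le_compat_l; [apply pow_le; lra|].
    replace n with (k + (n - k))%nat by lia. rewrite pow_add.
    rewrite <- (Rmult_1_r (eps ^ k)) at 2.
    apply Rmult_le_compat_l; [apply pow_le; lra|].
    rewrite <- (pow1 (n - k)); apply pow_incr; lra.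
  - replace (exp (eps * x)) with (exp (x * eps / INR k) ^ k)
      by (rewrite <- exp_mult_INR; f_equal; field; lra).
    rewrite <- Rpow_mult_distr. apply pow_incr; split; [apply Rmult_le_pos; lra|].
    pose proof (exp_ineq1_le (x * eps / INR k + - (1))) as HE.
    rewrite exp_plus in HE.
    pose proof (Rmult_le_compat_l _ _ _ (Rlt_le _ _ (exp_pos (x * eps / INR k))) exp_m1_le).
    replace (x * eps) with (INR k * (x * eps / INR k)) at 1 by (field; lra).
    rewrite Rmult_assoc; apply Rmult_le_compat_l; lra.
Qed.

(** With [M = 2 D / eps^n] and [r <= (50/41) sin r], the requirement becomes
    one on [sin r ^ (4n)]; one factor [sin r] matches the right side and the
    remaining [4n - 1] must be of order [eps^(2n)]. *)
Lemma strong_bound_of_monomials (n : nat) (x r eps D K : R) : 0 < x ->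
  0 < r <= 21 / 20 -> 0 < eps -> 0 <= D -> 0 <= K ->
  sin r ^ (4 * n - 1) <= K * eps ^ (2 * n) -> (1 <= n)%nat ->
  Rabs (p n x) * eps ^ n <= D * exp (eps * x) ->
  D ^ 2 * (63 / 20 * INR n * 16 ^ n * (50 / 41) ^ (4 * n) * K) <= INR (fact (4 * n)) ->
  strong_bound n x r eps.
Proof.
  intros Hx Hr He HD HK HS Hn HP HF.
  assert (Hen : 0 < eps ^ n) by (apply pow_lt; trivial).
  exists (2 * D / eps ^ n); split; [|split].
  - apply Rdiv_le_0_compat; lra.
  - replace (2 * D / eps ^ n * (exp (eps * x) / 2)) with (D * exp (eps * x) / eps ^ n)
      by (field; lra).
    apply (fun H => proj1 (Rle_div_r _ _ _ H)); trivial.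
  - pose proof (sin_ge_linear r ltac:(lra)) as Hlin.
    assert (Hsr : 0 < sin r) by lra.
    assert (Hr4 : r ^ (4 * n) <= (50 / 41) ^ (4 * n) * (sin r * (K * eps ^ (2 * n)))).
    { apply Rle_trans with ((50 / 41) ^ (4 * n) * sin r ^ (4 * n)).
      - rewrite <- Rpow_mult_distr; apply pow_incr; lra.
      - apply Rmult_le_compat_l; [apply pow_le; lra|].
        replace (4 * n)%nat with (S (4 * n - 1)) by lia.
        rewrite <- tech_pow_Rmult. apply Rmult_le_compat_l; [lra|].
        replace (S (4 * n - 1)) with (4 * n)%nat by lia. exact HS. }
    rewrite pow4_2n.
    assert (Hc : 0 <= (2 * D / eps ^ n) ^ 2 * (63 / 20 * INR n * 16 ^ n)).
    { apply Rmult_le_pos; [apply pow2_ge_0|].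
      apply Rmult_le_pos; [|apply pow_le; lra].
      apply Rmult_le_pos; [lra|apply pos_INR]. }
    apply (Rmult_le_compat_l _ _ _ Hc) in Hr4.
    apply (Rmult_le_compat_r (4 * sin r)) in HF; [|lra].
    replace (eps ^ (2 * n)) with (eps ^ n * eps ^ n) in Hr4
      by (rewrite <- pow_add; f_equal; lia).
    replace ((2 * D / eps ^ n) ^ 2 * (63 / 20 * INR n * 16 ^ n) *
        ((50 / 41) ^ (4 * n) * (sin r * (K * (eps ^ n * eps ^ n)))))
     with (D ^ 2 * (63 / 20 * INR n * 16 ^ n * (50 / 41) ^ (4 * n) * K) * (4 * sin r))
     in Hr4 by (field; lra).
    lra.
Qed.

(** The constraint gives both [s^2 <= eps] (its right side is
    [eps - (eps - 1/2)^2]) and [s^2 <= 3 eps^2] (its right side is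
    [3 eps^2 - (2 eps - 1/2)^2]), hence
    [s <= 7/4 eps].  The first serves [2n - 1] times, the second once. *)
Lemma sin_pow_le (n : nat) (s eps : R) : (2 <= n)%nat -> 0 <= s -> 0 < eps ->
  s ^ 2 <= 2 * eps - eps ^ 2 - 1 / 4 -> s ^ (4 * n - 1) <= 7 / 4 * eps ^ (2 * n).
Proof.
  intros Hn Hs He H.
  assert (H1 : s ^ 2 <= eps) by (pose proof (pow2_ge_0 (eps - 1 / 2)); lra).
  assert (H2 : s <= 7 / 4 * eps).
  { apply Rsqr_incr_0_var; [unfold Rsqr|lra].
    pose proof (pow2_ge_0 (2 * eps - 1 / 2)). nra. }
  replace (4 * n - 1)%nat with (S (2 * (2 * n - 1))) by lia.
  replace (2 * n)%nat with (S (2 * n - 1)) at 2 by lia.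
  rewrite <- !tech_pow_Rmult, pow_mult, <- Rmult_assoc.
  apply Rmult_le_compat; trivial; [apply pow_le, pow2_ge_0|].
  apply pow_incr; split; trivial; apply pow2_ge_0.
Qed.

(** For [n = 1] the constant [7/4] of the general estimate is too large.  Here
    [s] is replaced by its tangent bound in [s^2] at [s = 6/10], close to the critical
    value, leaving a quartic in [eps]. *)
Lemma sin_cube_le (s eps : R) : 0 <= s -> 0 < eps <= 1 ->
  s ^ 2 <= 2 * eps - eps ^ 2 - 1 / 4 -> s ^ 3 <= 159 / 100 * eps ^ 2.
Proof.
  intros Hs He H.
  assert (H1 : s <= (s ^ 2 + 36 / 100) / (12 / 10)) by (pose proof (pow2_ge_0 (s - 6 / 10)); lra).
  set (v := 2 * eps - eps ^ 2 - 1 / 4) in *.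
  pose proof (pow2_ge_0 s).
  assert (s ^ 3 <= v * ((v + 36 / 100) / (12 / 10))).
  { replace (s ^ 3) with (s ^ 2 * s) by ring.
    apply Rmult_le_compat; lra. }
  eapply Rle_trans; [eassumption|]. unfold v.
  clear - He.
  (* The quartic has the least slack near eps = 37/100. *)
  assert (0 <= eps * (1 - eps) * (eps - 37 / 100) ^ 2)
    by (apply Rmult_le_pos; [apply Rmult_le_pos; lra|apply pow2_ge_0]).
  assert (0 <= eps * (eps - 37 / 100) ^ 2)
    by (apply Rmult_le_pos; [lra|apply pow2_ge_0]).
  pose proof (pow2_ge_0 (eps - 26 / 100)). lra.
Qed.

Ltac eval_integers :=
  repeat match goal with
  | |- context [cosh_coef ?a ?b] =>
      let v := eval vm_compute in (cosh_coef a b) in change (cosh_coef a b) with v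
  | |- context [Zfact ?a] =>
      let v := eval vm_compute in (Zfact a) in change (Zfact a) with v
  | |- context [Z.of_nat ?a] =>
      let v := eval vm_compute in (Z.of_nat a) in change (Z.of_nat a) with v
  end.

(** Here [D] bounds the sum of the positive terms of [p n], and that of the
    negative ones, and [K] is the constant relating [sin r ^ (4n - 1)] to
    [eps^(2n)]. *)
Ltac settle reduction D K :=
  apply (reduction D K);
  [ lra | lra | auto with arith
  | cbn [sum_f_R0]; eval_integers; split; lra
  | cbn [Nat.mul Nat.add]; eval_integers; lra ].

(** The constants [D] round up what the maxima of the monomials give; for
    [n = 1] the final comparison holds with a margin of less than one part in a
    thousand, so [D] is the bound on [exp (- 1)] itself. *)
Lemma small_n_case (n : nat) (x r eps : R) : (1 <= n < 8)%nat -> 0 < x ->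
  0 < r <= 21 / 20 -> 0 < eps <= 1 -> sin r ^ 2 <= 2 * eps - eps ^ 2 - 1 / 4 ->
  strong_bound n x r eps.
Proof.
  intros Hn Hx Hr He Hs.
  assert (Hsr : 0 <= sin r) by (pose proof (sin_ge_linear r ltac:(lra)); lra).
  pose proof (sin_cube_le (sin r) eps Hsr He Hs) as Hcube.
  assert (Hsin : (2 <= n)%nat -> sin r ^ (4 * n - 1) <= 7 / 4 * eps ^ (2 * n))
    by (intros; apply sin_pow_le; trivial; lra).
  assert (Hmono : forall k, (1 <= k <= n)%nat ->
    0 <= x ^ k * eps ^ n <= (INR k * (36792 / 100000)) ^ k * exp (eps * x)).
  { intros k Hk; split; [apply Rmult_le_pos; apply pow_le; lra|].
    apply pow_mul_le_exp; trivial. }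
  assert (Hcase : forall D K, 0 <= D -> 0 <= K ->
    sin r ^ (4 * n - 1) <= K * eps ^ (2 * n) ->
    - (D * exp (eps * x)) <=
      sum_f_R0 (fun k => (-1) ^ k * IZR (cosh_coef n k) * x ^ k) n * eps ^ n
      <= D * exp (eps * x) ->
    D ^ 2 * (63 / 20 * IZR (Z.of_nat n) * 16 ^ n * (50 / 41) ^ (4 * n) * K)
      <= IZR (Zfact (4 * n)) ->
    strong_bound n x r eps).
  { intros D K HD HK HS HP HF.
    apply (strong_bound_of_monomials n x r eps D K); trivial; try lra; try lia.
    - rewrite p_eq_sum, <- (Rabs_pos_eq (eps ^ n)) by (apply pow_le; lra).
      rewrite <- Rabs_mult; apply Rabs_le; exact HP.
    - rewrite INR_fact_Z, INR_IZR_INZ; exact HF. }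
  pose proof (Hmono 1%nat) as M1. pose proof (Hmono 2%nat) as M2.
  pose proof (Hmono 3%nat) as M3. pose proof (Hmono 4%nat) as M4.
  pose proof (Hmono 5%nat) as M5. pose proof (Hmono 6%nat) as M6.
  pose proof (Hmono 7%nat) as M7. clear Hmono.
  rewrite INR_IZR_INZ in M1, M2, M3, M4, M5, M6, M7.
  cbn [Z.of_nat Pos.of_succ_nat Pos.succ] in M1, M2, M3, M4, M5, M6, M7.
  assert (H : (n = 1 \/ n = 2 \/ n = 3 \/ n = 4 \/ n = 5 \/ n = 6 \/ n = 7)%nat) by lia.
  repeat destruct H as [H | H]; subst n;
    repeat match goal with
    | M : (1 <= _ <= _)%nat -> _ |- _ => specialize (M ltac:(lia)) || clear M end.
  - settle Hcase (36792 / 100000) (159 / 100).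
  - settle Hcase (163 / 100) (7 / 4).
  - settle Hcase (206 / 10) (7 / 4).
  - settle Hcase 527 (7 / 4).
  - settle Hcase 22900 (7 / 4).
  - settle Hcase 1520000 (7 / 4).
  - settle Hcase 142000000 (7 / 4).
Qed.

(** * The bound on p_n *)

Theorem lemma1 (x : R) (n : nat) (eps alpha : R)
  (hx : 0 < x) (hn : (1 <= n)%nat)
  (heps : 1 - sqrt 3 / 2 < eps <= 1)
  (halpha : 0 < alpha <= 2 * acos (sqrt (1 + 4 * (1 - eps) ^ 2) / 2)) :
  Rabs (p n x) <=
    sqrt ((2 ^ (4 * n) - 1) * INR (fact (4 * n)) * sin (alpha / 2) /
          (PI * INR n * alpha ^ (4 * n) *
             (2 ^ (4 * n - 2) + 6 / PI ^ 2 - 1)))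
    * (exp (eps * x) / 2).
Proof.
  assert (H3 : sqrt 3 ^ 2 = 3) by (apply pow2_sqrt; lra).
  pose proof (sqrt_pos 3).
  assert (Heps : 0 < eps <= 1) by nra.
  assert (Hd : (1 - eps) ^ 2 <= 3 / 4) by nra.
  set (c := sqrt (1 + 4 * (1 - eps) ^ 2) / 2) in *.
  pose proof (pow2_ge_0 (1 - eps)).
  assert (Hc2 : c ^ 2 = 1 / 4 + (1 - eps) ^ 2).
  { unfold c. unfold Rdiv. rewrite Rpow_mult_distr, pow2_sqrt by lra. field. }
  assert (Hc0 : 0 <= c) by (unfold c; pose proof (sqrt_pos (1 + 4 * (1 - eps) ^ 2)); lra).
  assert (Hc : 1 / 2 <= c <= 1) by nra.
  pose proof (acos_bound c) as Hac.
  set (r := alpha / 2).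
  assert (Hr : 0 < r <= acos c) by (unfold r; lra).
  replace (alpha ^ (4 * n)) with ((2 * r) ^ (4 * n)) by (unfold r; f_equal; field).
  (* The constraint on alpha bounds cos r below, which limits both r and sin r. *)
  assert (Hcos : c <= cos r).
  { rewrite <- (cos_acos c) by lra. apply cos_decr_1; lra. }
  assert (Hr1 : r <= 21 / 20) by (apply le_of_cos_ge_half; lra).
  assert (Hsin : sin r ^ 2 <= 2 * eps - eps ^ 2 - 1 / 4).
  { pose proof (sin2_cos2 r) as Hsc; unfold Rsqr in Hsc. nra. }
  apply bound_of_strong_bound; trivial; [lra|].
  destruct (le_lt_dec 8 n); [apply large_n_case|apply small_n_case]; trivial; lra || lia.
Qed.
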